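(* Let $\mathbb{F}$ be an arbitrary field with more than $2$ elements, let $n\ge 3$ and $k\ge 2$ be integers, and let $\Xi\subset\mathcal{S}_k$ be a fixed admissible subset of permutations. Suppose that two given homogeneous multilinear polynomials $$\mathfrak{p}_1(x_1,\dots,x_k):=x_1\cdots x_k-\sum_{\sigma\in\Xi}\alpha_\sigma\, x_{\sigma(1)}\cdots x_{\sigma(k)}\qquad(\alpha_\sigma\in\mathbb{F}),$$ $$\mathfrak{p}_2(x_1,\dots,x_k):=x_1\cdots x_k-\sum_{\sigma\in\Xi}\beta_\sigma\, x_{\sigma(1)}\cdots x_{\sigma(k)}\qquad(\beta_\sigma\in\mathbb{F})$$ satisfy $\sum_{\sigma\in\Xi}\alpha_\sigma=1=\sum_{\sigma\in\Xi}\beta_\sigma$. Then any bijection $\Phi:\mathcal{M}_n(\mathbb{F})\to\mathcal{M}_n(\mathbb{F})$ which maps the zeros of $\mathfrak{p}_1$ to the zeros of $\mathfrak{p}_2$ preserves commutativity.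
   Context: $\mathcal{M}_n(\mathbb{F})$ is the algebra of $n\times n$ matrices over $\mathbb{F}$; $\mathcal{S}_k$ is the set of all permutations of $\{1,\dots,k\}$; the variables $x_i$ do not commute. A subset $\Xi\subseteq\mathcal{S}_k$ of nonidentity permutations is called admissible if: (i) there exists $t\in\{1,\dots,k\}$ such that each $\sigma\in\Xi$ fixes the first $t-1$ elements $1,\dots,t-1$, but $\sigma(t)\ne t$; (ii) there exist integers $w,u,v\in\{1,\dots,k\}$ with $u<v$ (and $w+1\le k$) such that $\sigma(w)=v$ and $\sigma(w+1)=u$ for each $\sigma\in\Xi$. $\Phi$ maps the zeros of $\mathfrak{p}_1$ to the zeros of $\mathfrak{p}_2$ if $\mathfrak{p}_1(A_1,\dots,A_k)=0$ implies $\mathfrak{p}_2(\Phi(A_1),\dots,\Phi(A_k))=0$ for all $A_1,\dots,A_k\in\mathcal{M}_n(\mathbb{F})$. $\Phi$ preserves commutativity if $XY=YX$ implies $\Phi(X)\Phi(Y)=\Phi(Y)\Phi(X)$. No linearity or additivity of $\Phi$ is assumed. *)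

(* Defs.v *)
From HB Require Import structures.
From mathcomp Require Import all_boot all_order all_algebra all_fingroup.

Set Implicit Arguments.
Unset Strict Implicit.
Unset Printing Implicit Defensive.

Import GRing.Theory.
Local Open Scope ring_scope.

(* Positions 1, ..., k are represented by the elements 0, ..., k-1 of 'I_k. *)

(* [w'] is the position w + 1, so in particular w + 1 is a valid position. *)
Definition admissible (k : nat) (Xi : {set 'S_k}) : Prop :=
  [/\ forall s : 'S_k, s \in Xi -> s <> 1%g,
      exists t : 'I_k, forall s : 'S_k, s \in Xi ->
        (forall i : 'I_k, (i < t)%N -> s i = i) /\ s t <> t
    & exists w w' u v : 'I_k,
        [/\ w' = w.+1 :> nat, (u < v)%N
          & forall s : 'S_k, s \in Xi -> s w = v /\ s w' = u]].

(* Value at the tuple of matrices A of the noncommutative polynomial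
   x_1 ... x_k - \sum_(s in Xi) alpha_s x_(s 1) ... x_(s k); the products are
   taken from left to right in increasing order of the index. *)
Definition mlpoly (F : fieldType) (n k : nat) (Xi : {set 'S_k})
    (alpha : 'S_k -> F) (A : 'I_k -> 'M[F]_n) : 'M[F]_n :=
  \prod_(i < k) A i - \sum_(s in Xi) alpha s *: \prod_(i < k) A (s i).

Definition maps_zeros (F : fieldType) (n k : nat)
    (p1 p2 : ('I_k -> 'M[F]_n) -> 'M[F]_n) (Phi : 'M[F]_n -> 'M[F]_n) : Prop :=
  forall A : 'I_k -> 'M[F]_n, p1 A = 0 -> p2 (fun i => Phi (A i)) = 0.

Definition preserves_commutativity (F : fieldType) (n : nat)
    (Phi : 'M[F]_n -> 'M[F]_n) : Prop :=
  forall X Y : 'M[F]_n, X *m Y = Y *m X -> Phi X *m Phi Y = Phi Y *m Phi X.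

(* Main.v *)
(* Let t be the first position moved by Xi, D and X preimages of 1 and of an
   idempotent e, and Z a scalar matrix. The tuple (D, ..., D, Z, X, ..., X), with
   Z in position t, is a zero of p_1 because Z commutes with X; that its image is
   a zero of p_2 gives S e = W e, where S = Phi Z and every word of W starts with
   e, so S e = e S e. Replacing e by 1 - e shows that S commutes with all
   idempotents, hence is scalar. By injectivity Phi 0 or Phi 1 is a nonzero scalar
   a. For commuting X, Y the tuple with X in position u, Y in position v and the
   corresponding 0 or 1 elsewhere is a zero of p_1, and in p_2 its image gives
   a^(k-2) (Phi X Phi Y - Phi Y Phi X) = 0. *)
Require Import Defs.
From HB Require Import structures.
From mathcomp Require Import all_boot all_order all_algebra all_fingroup.

Set Implicit Arguments.
Unset Strict Implicit.
Unset Printing Implicit Defensive.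

Import GRing.Theory.
Local Open Scope ring_scope.

(** Induction on [s1]: its head is located in [s2] and moved to the front past the prefix [p1], all
    of whose factors commute with it. *)
Lemma perm_prod_comm (R : pzRingType) (I : eqType) (A : I -> R) (s1 s2 : seq I) :
  {in s1 &, forall i j, GRing.comm (A i) (A j)} -> perm_eq s1 s2 ->
  \prod_(i <- s1) A i = \prod_(i <- s2) A i.
Proof.
elim: s1 s2 => [|x s1 IHs] s2 cA; first by rewrite perm_sym => /perm_nilP->.
move=> eq12; have s2x: x \in s2 by rewrite -(perm_mem eq12) mem_head.
case/splitPr: s2 / s2x eq12 => p1 p2 eq12.
have eq1: perm_eq s1 (p1 ++ p2).
  by rewrite -(perm_cons x) (permPl eq12) perm_catC /= perm_cons perm_catC.
rewrite big_cons big_cat big_cons /= mulrA.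
rewrite (IHs (p1 ++ p2)) //; last first.
  by move=> i j si sj; apply: cA; rewrite inE ?si ?sj orbT.
rewrite big_cat /= mulrA; congr (_ * _).
rewrite big_seq; apply: commr_prod => i p1i; apply: cA; rewrite ?mem_head //.
by rewrite inE (perm_mem eq1) mem_cat p1i orbT.
Qed.

Lemma mem_take_enum_ord (k t : nat) (i : 'I_k) :
  (t <= k)%N -> i \in take t (enum 'I_k) = (i < t)%N.
Proof.
move=> le_tk; rewrite -(mem_map val_inj) map_take val_enum_ord take_iota.
by rewrite mem_iota (minn_idPl le_tk).
Qed.

Lemma mem_drop_enum_ord (k t : nat) (i : 'I_k) :
  i \in drop t (enum 'I_k) = (t <= i)%N.
Proof.
rewrite -(mem_map val_inj) map_drop val_enum_ord drop_iota mem_iota add0n.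
have [le_ti|//] := leqP t i; rewrite subnKC ?ltn_ord //.
exact: leq_trans le_ti (ltnW (ltn_ord i)).
Qed.

Lemma drop_enum_ord (k : nat) (t : 'I_k) :
  drop t (enum 'I_k) = t :: drop t.+1 (enum 'I_k).
Proof. by rewrite (drop_nth t) ?nth_ord_enum // size_enum_ord. Qed.

(* [big_enum] is only available for commutative operations. *)
Lemma big_enum_noncomm (R : Type) (idx : R) (op : R -> R -> R) (I : finType)
    (A : I -> R) :
  \big[op/idx]_(i <- enum I) A i = \big[op/idx]_i A i.
Proof. by rewrite enumT [index_enum _]unlock. Qed.

Lemma prod_ord_split (R : pzRingType) (k : nat) (t : 'I_k) (A : 'I_k -> R) :
  \prod_(i < k) A i = \prod_(i <- take t (enum 'I_k)) A i *
                      (A t * \prod_(i <- drop t.+1 (enum 'I_k)) A i).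
Proof.
by rewrite -big_enum_noncomm -{1}(cat_take_drop t (enum _)) big_cat drop_enum_ord big_cons.
Qed.

Lemma prod_ord_pair (R : pzRingType) (k : nat) (u v : 'I_k) (X Y : R) :
  (u < v)%N ->
  \prod_(i < k) (if i == u then X else if i == v then Y else 1) = X * Y.
Proof.
move=> lt_uv; have neq_vu: v != u by rewrite -val_eqE gtn_eqF.
set A := fun i => if i == u then X else if i == v then Y else 1.
have A1 i : A i = if i \in [:: u; v] then A i else 1.
  by rewrite /A !inE; case: eqP => //; case: eqP.
rewrite -[LHS]big_enum_noncomm (eq_bigr _ (fun i _ => A1 i)) -big_mkcond -big_filter.
(* Both lists are strictly increasing and have the same elements, so they coincide. *)
have -> : [seq i <- enum 'I_k | i \in [:: u; v]] = [:: u; v].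
  apply: (@irr_sorted_eq _ (relpre val ltn)) => /=.
  - by move=> i j l; apply: ltn_trans.
  - by move=> i; apply: ltnn.
  - apply: sorted_filter; first by move=> i j l; apply: ltn_trans.
    by rewrite -sorted_map val_enum_ord iota_ltn_sorted.
  - by rewrite lt_uv.
  - by move=> i; rewrite mem_filter mem_enum andbT.
by rewrite !big_cons big_nil /= mulr1 /A !eqxx (negPf neq_vu).
Qed.

Lemma mlpoly_eq0 (F : fieldType) (n k : nat) (Xi : {set 'S_k})
    (alpha : 'S_k -> F) (A : 'I_k -> 'M[F]_n) :
  \sum_(s in Xi) alpha s = 1 ->
  (forall s, s \in Xi -> \prod_(i < k) A (s i) = \prod_(i < k) A i) ->
  mlpoly Xi alpha A = 0.
Proof.
move=> sum_alpha eqA; rewrite /mlpoly.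
rewrite (eq_bigr (fun s => alpha s *: \prod_(i < k) A i)) => [|s Xi_s]; last first.
  by rewrite eqA.
by rewrite -scaler_suml sum_alpha scale1r subrr.
Qed.

(** Idempotents span all matrices: for [i != j] both [E_ii] and [E_ii + E_ij] are idempotent, and
    their difference is the matrix unit [E_ij]. *)
Lemma idem_central_is_scalar (F : fieldType) (n : nat) (S : 'M[F]_n) :
  (forall e : 'M[F]_n, e *m e = e -> S *m e = e *m S) -> is_scalar_mx S.
Proof.
move=> cS; apply/is_scalar_mxP; case: n S cS => [|n] S cS.
  by exists 0; apply/matrixP => -[].
have cSd i j : S *m delta_mx i j = delta_mx i j *m S.
  have idem_ii: delta_mx i i *m delta_mx i i = delta_mx i i :> 'M[F]_n.+1.
    by rewrite mul_delta_mx.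
  have [<-|neq_ij] := eqVneq i j; first exact: cS.
  have := cS (delta_mx i i + delta_mx i j); rewrite mulmxDl !mulmxDr.
  rewrite !mul_delta_mx !(mul_delta_mx_0 _ _ _ (_ : j != i)) 1?eq_sym //.
  by rewrite !addr0 mulmxDl cS // => /(_ erefl)/addrI.
exists (S 0 0); apply/matrixP => i j; rewrite !mxE.
(* The entry (i, 0) of [S E_j0] is [S i j], while that of [E_j0 S] is [S 0 0] if [i = j] and 0
   otherwise. *)
have /matrixP/(_ i 0) := cSd j 0.
rewrite !mxE (bigD1 j) //= big1 => [|l neq_lj]; last first.
  by rewrite !mxE (negPf neq_lj) mulr0.
rewrite (bigD1 0) //= big1 => [|l neq_l0]; last first.
  by rewrite !mxE (negPf neq_l0) andbF mul0r.
by rewrite !mxE !eqxx /= mulr1 !addr0 andbT mulr_natl.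
Qed.

Lemma perm_map_drop_enum_ord (k t : nat) (s : 'S_k) :
  (t <= k)%N -> (forall i : 'I_k, (i < t)%N -> s i = i) ->
  perm_eq (map s (drop t (enum 'I_k))) (drop t (enum 'I_k)).
Proof.
move=> le_tk fix_s; rewrite -(perm_cat2l (take t (enum 'I_k))) cat_take_drop.
have {1}-> : take t (enum 'I_k) = map s (take t (enum 'I_k)).
  rewrite -[LHS]map_id; apply/eq_in_map => i.
  by rewrite mem_take_enum_ord // => /fix_s->.
rewrite -map_cat cat_take_drop; apply: uniq_perm.
- by rewrite (map_inj_uniq (@perm_inj _ s)) enum_uniq.
- exact: enum_uniq.
by move=> i; rewrite mem_enum -(permKV s i) mem_map ?mem_enum //; apply: perm_inj.
Qed.

Definition step_tuple (T : Type) (k : nat) (t : 'I_k) (D W X : T) (i : 'I_k) : T :=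
  if (i < t)%N then D else if i == t then W else X.

(** [D] may be arbitrary, since it fills only positions fixed by [s]; from [t] on, [s] merely
    permutes factors that commute pairwise. *)
Lemma prod_step_tuple_perm (R : pzRingType) (k : nat) (t : 'I_k) (D W X : R)
    (s : 'S_k) :
  (forall i : 'I_k, (i < t)%N -> s i = i) -> GRing.comm W X ->
  \prod_(i < k) step_tuple t D W X (s i) = \prod_(i < k) step_tuple t D W X i.
Proof.
move=> fix_s cWX; have le_tk : (t <= k)%N by apply: ltnW.
rewrite -[LHS]big_enum_noncomm -[RHS]big_enum_noncomm.
rewrite -(cat_take_drop t (enum 'I_k)) !big_cat /=; congr (_ * _).
  by apply: eq_big_seq => i; rewrite mem_take_enum_ord // => /fix_s->.
rewrite -(big_map s xpredT (step_tuple t D W X)).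
have eq_s := perm_map_drop_enum_ord le_tk fix_s.
apply: perm_prod_comm (eq_s) => i j.
rewrite !(perm_mem eq_s) !mem_drop_enum_ord /step_tuple => le_ti le_tj.
rewrite ltnNge le_ti ltnNge le_tj /=.
by case: (i == t); case: (j == t) => //; apply: commr_sym.
Qed.

Lemma maps_central_idem (F : fieldType) (n k : nat) (Xi : {set 'S_k})
    (t : 'I_k) (alpha beta : 'S_k -> F) (Phi : 'M[F]_n -> 'M[F]_n)
    (Z e : 'M[F]_n) :
  (forall s : 'S_k, s \in Xi ->
     (forall i : 'I_k, (i < t)%N -> s i = i) /\ s t <> t) ->
  \sum_(s in Xi) alpha s = 1 -> bijective Phi ->
  maps_zeros (mlpoly Xi alpha) (mlpoly Xi beta) Phi ->
  (forall X, GRing.comm Z X) -> e *m e = e ->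
  Phi Z *m e = e *m Phi Z *m e.
Proof.
move=> Xi_t sum_alpha [Psi PhiK PsiK] zeros cZ ee; set S := Phi Z.
have le_tk : (t <= k)%N by apply: ltnW.
have /zeros: mlpoly Xi alpha (step_tuple t (Psi 1) Z (Psi e)) = 0.
  apply: mlpoly_eq0 => // s /Xi_t[fix_s _].
  by rewrite prod_step_tuple_perm //; apply: cZ.
pose A := step_tuple t 1 S e.
have PhiA i : Phi (step_tuple t (Psi 1) Z (Psi e) i) = A i.
  by rewrite /A /step_tuple; case: ifP => _; rewrite ?PsiK //; case: ifP.
rewrite /mlpoly; under eq_bigr do rewrite PhiA.
under [X in _ - X]eq_bigr do under eq_bigr do rewrite PhiA.
move/eqP; rewrite subr_eq0 => /eqP eqW.
have take1 : \prod_(i <- take t (enum 'I_k)) A i = 1.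
  apply: big1_seq => i /=.
  by rewrite mem_take_enum_ord // /A /step_tuple => ->.
(* The product is [S] times a power of [e], which is empty when [t] is the last position; the extra
   factor [e] on the right makes the identity uniform. *)
have We : (\prod_(i < k) A i) *m e = S *m e.
  rewrite (prod_ord_split t) take1 mul1r {1}/A /step_tuple ltnn eqxx -mulmxA.
  congr (_ *m _); rewrite big_seq; elim/big_rec: _ => [|i W]; first exact: mul1mx.
  rewrite mem_drop_enum_ord -mulmxA => lt_ti ->.
  by rewrite /A /step_tuple ltnNge (ltnW lt_ti) -val_eqE gtn_eqF.
(* By [eqW] the product is a combination of permuted words. After the leading 1s, such a word has
   [A (s t)] in position [t], and this is [e]. *)
have eW : e *m (\prod_(i < k) A i) = \prod_(i < k) A i.
  rewrite eqW mulmx_sumr; apply: eq_bigr => s /Xi_t[fix_s /eqP neq_st].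
  rewrite -scalemxAr; congr (_ *: _); rewrite (prod_ord_split t).
  rewrite (eq_big_seq A); last first.
    by move=> i; rewrite mem_take_enum_ord // => /fix_s->.
  rewrite take1 mul1r mulmxA; congr (_ *m _).
  rewrite /A /step_tuple (negPf neq_st); case: ltnP => // lt_st.
  (* If [s t] were below [t], it would be fixed by [s], and injectivity would force [s t = t]. *)
  by have /perm_inj/eqP := fix_s _ lt_st; rewrite (negPf neq_st).
by rewrite -mulmxA -We mulmxA eW.
Qed.

Lemma maps_central_to_scalar (F : fieldType) (n k : nat) (Xi : {set 'S_k})
    (t : 'I_k) (alpha beta : 'S_k -> F) (Phi : 'M[F]_n -> 'M[F]_n)
    (Z : 'M[F]_n) :
  (forall s : 'S_k, s \in Xi ->
     (forall i : 'I_k, (i < t)%N -> s i = i) /\ s t <> t) ->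
  \sum_(s in Xi) alpha s = 1 -> bijective Phi ->
  maps_zeros (mlpoly Xi alpha) (mlpoly Xi beta) Phi ->
  (forall X, GRing.comm Z X) -> is_scalar_mx (Phi Z).
Proof.
move=> Xi_t sum_alpha bijPhi zeros cZ; apply: idem_central_is_scalar => e ee.
have half f := maps_central_idem Xi_t sum_alpha bijPhi zeros cZ (e := f).
have ff : (1%:M - e) *m (1%:M - e) = 1%:M - e.
  by rewrite mulmxBr mulmx1 mulmxBl mul1mx ee subrr subr0.
(* For [S := Phi Z], the identity at [1 - e] amounts to [e S (1 - e) = 0], that is [e S = e S e];
   the identity at [e] turns the right side into [S e]. *)
have := half _ ff; rewrite mulmxBl mul1mx !mulmxBr !mulmx1 mulmxBl -half // subrr subr0.
by move=> /eqP; rewrite -subr_eq0 opprB addrC addrA subrK subr_eq0 => /eqP.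
Qed.

(* [scaler_prod] does not apply, as 'M[F]_n has no algebra structure for n = 0. *)
Lemma prod_scalemx (F : fieldType) (n : nat) (I : Type) (r : seq I) (c : I -> F)
    (B : I -> 'M[F]_n) :
  \prod_(i <- r) (c i *: B i) = \prod_(i <- r) c i *: \prod_(i <- r) B i.
Proof.
elim/big_rec3: _ => [|i M x N _ ->]; first by rewrite scale1r.
by rewrite -[LHS]scalemxAl -scalemxAr scalerA.
Qed.

Lemma maps_zeros_commute (F : fieldType) (n k : nat) (Xi : {set 'S_k})
    (alpha beta : 'S_k -> F) (Phi : 'M[F]_n -> 'M[F]_n) (Z X Y : 'M[F]_n)
    (a : F) (w w' u v : 'I_k) :
  (w < w')%N -> (u < v)%N ->
  (forall s : 'S_k, s \in Xi -> s w = v /\ s w' = u) ->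
  \sum_(s in Xi) alpha s = 1 -> \sum_(s in Xi) beta s = 1 ->
  maps_zeros (mlpoly Xi alpha) (mlpoly Xi beta) Phi ->
  (forall X, GRing.comm Z X) -> Phi Z = a%:M -> a != 0 ->
  X *m Y = Y *m X -> Phi X *m Phi Y = Phi Y *m Phi X.
Proof.
move=> lt_w lt_uv Xi_uv sum_alpha sum_beta zeros cZ PhiZ a_neq0 cXY.
pose A i := if i == u then X else if i == v then Y else Z.
have cA i j : GRing.comm (A i) (A j).
  rewrite /A; case: ifP => _; [|case: ifP => _]; last exact: cZ;
    (case: ifP => _; [|case: ifP => _]) => //; apply: commr_sym; exact: cZ.
have /zeros: mlpoly Xi alpha A = 0.
  apply: mlpoly_eq0 => // s _.
  rewrite -[LHS]big_enum_noncomm -[RHS]big_enum_noncomm -(big_map s xpredT A).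
  apply: perm_prod_comm => [i j _ _|]; first exact: cA.
  (* With an empty fixed prefix, [s] permutes the whole enumeration. *)
  by have := @perm_map_drop_enum_ord k 0 s; rewrite !drop0; apply.
pose B i := if i == u then Phi X else if i == v then Phi Y else 1.
(* The scalars are split off into [c], so that [B] is 1 away from [u] and [v]. *)
pose c i : F := if (i == u) || (i == v) then 1 else a.
have PhiA i : Phi (A i) = c i *: B i.
  rewrite /A /B /c; case: (i == u); first by rewrite scale1r.
  case: (i == v); first by rewrite scale1r.
  by rewrite PhiZ -scalemx1.
rewrite /mlpoly; under eq_bigr do rewrite PhiA.
under [X in _ - X]eq_bigr do under eq_bigr do rewrite PhiA.
rewrite prod_scalemx prod_ord_pair //.
have prodB (s : 'S_k) : s \in Xi ->
    \prod_(i < k) (c (s i) *: B (s i)) = (\prod_(i < k) c i) *: (Phi Y *m Phi X).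
  move=> /Xi_uv[sw sw']; rewrite prod_scalemx; congr (_ *: _).
    by rewrite [RHS](reindex_inj (@perm_inj _ s)).
  (* Along [s], [Phi Y] stands in position [w] and [Phi X] in the later position [w']: the order of
     the two factors is reversed. *)
  rewrite -[RHS](prod_ord_pair _ _ lt_w); apply: eq_bigr => i _.
  rewrite /B -sw -sw' !(inj_eq perm_inj); case: eqP => // ->.
  by rewrite -val_eqE gtn_eqF.
rewrite (eq_bigr (fun s => beta s *: ((\prod_(i < k) c i) *: (Phi Y *m Phi X)))).
  (* All words of the sum have the same value and the [beta s] add up to 1, so a multiple of the
     commutator remains; its coefficient is a product of factors 1 and [a], hence nonzero. *)
  rewrite -scaler_suml sum_beta scale1r -scalerBr => /eqP.
  rewrite scaler_eq0 subr_eq0 => /orP[|/eqP//].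
  rewrite prodf_seq_eq0 => /hasP[i _]; rewrite /c; case: ifP => _ /=.
    by rewrite oner_eq0.
  by rewrite (negPf a_neq0).
by move=> s Xi_s; rewrite prodB.
Qed.

Theorem theorem3p3 (F : fieldType)
  (hF : exists s : seq F, uniq s /\ (2 < size s)%N)
  (n k : nat) (hn : (3 <= n)%N) (hk : (2 <= k)%N)
  (Xi : {set 'S_k}) (hXi : admissible Xi)
  (alpha beta : 'S_k -> F)
  (halpha : \sum_(s in Xi) alpha s = 1) (hbeta : \sum_(s in Xi) beta s = 1)
  (Phi : 'M[F]_n -> 'M[F]_n) (hPhi : bijective Phi)
  (hzeros : maps_zeros (mlpoly Xi alpha) (mlpoly Xi beta) Phi) :
  preserves_commutativity Phi.
Proof.
have [_ [t Xi_t] [w [w' [u [v [def_w' lt_uv Xi_uv]]]]]] := hXi.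
move=> X Y; have lt_w : (w < w')%N by rewrite def_w'.
have c0 (M : 'M[F]_n) : GRing.comm 0 M by exact/commr_sym/commr0.
have c1 (M : 'M[F]_n) : GRing.comm 1 M by exact/commr_sym/commr1.
have scal := maps_central_to_scalar Xi_t halpha hPhi hzeros.
have /is_scalar_mxP[a Phi0] := scal _ c0.
have /is_scalar_mxP[b Phi1] := scal _ c1.
(* The filler [Z] is 0 if [Phi 0] is nonzero, and 1 otherwise. *)
have [a0|a_neq0] := eqVneq a 0; last first.
  exact: maps_zeros_commute lt_w lt_uv Xi_uv halpha hbeta hzeros c0 Phi0 a_neq0.
apply: (maps_zeros_commute lt_w lt_uv Xi_uv halpha hbeta hzeros c1 Phi1).
apply/eqP => b0; have: Phi 0 = Phi 1 by rewrite Phi0 Phi1 a0 b0.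
(* A diagonal position, at which the matrices 0 and 1 differ. *)
pose i : 'I_n := Ordinal (leq_trans (isT : (0 < 3)%N) hn).
move/(bij_inj hPhi)/matrixP/(_ i i)/eqP.
by rewrite !mxE eqxx eq_sym oner_eq0.
Qed.
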